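(* Let $\mathcal X$ be the state space (e.g. $\mathbb R^{n_x}$). For elements $a=V_a(\cdot,\cdot)$ and $b=V_b(\cdot,\cdot)$, which are functions $\mathcal X\times\mathcal X\to(-\infty,+\infty]$ bounded below, define the element $a\otimes b$ as the function $$(a\otimes b)(x,y)=\min_{z\in\mathcal X}\left\{V_a(x,z)+V_b(z,y)\right\}.$$ Then $\otimes$ is associative: $(a\otimes b)\otimes c=a\otimes(b\otimes c)$ for all elements $a,b,c$.
   Context: Elements represent conditional value functions of an optimal control problem whose stage costs are bounded below; the value $+\infty$ is used when the second state cannot be reached from the first. Convention: $\min$ is read as the infimum in the extended reals. *)

(* Defs.v *)
From HB Require Import structures.
From mathcomp Require Import all_boot all_order all_algebra.
From mathcomp Require Import boolp classical_sets reals constructive_ereal ereal.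

Set Implicit Arguments.
Unset Strict Implicit.
Unset Printing Implicit Defensive.

Import Order.TTheory GRing.Theory Num.Theory.
Local Open Scope classical_set_scope.
Local Open Scope ereal_scope.

(* Conditional value functions X * X -> (-oo, +oo] that are bounded below.
   The lower bound m is a real number, so the value -oo is excluded, while
   +oo (second state unreachable from the first) is allowed. *)
Record element (R : realType) (X : Type) := Element {
  value :> X -> X -> \bar R;
  value_bounded_below : exists m : R, forall x y, m%:E <= value x y }.

(* The minimum over z is an infimum in the extended reals. Neither summand is
   -oo, so the library's convention for +oo + -oo plays no role. *)
Definition otimes_value (R : realType) (X : Type) (a b : element R X)
    (x y : X) : \bar R :=
  ereal_inf (range (fun z : X => a x z + b z y)).

Lemma otimes_bounded_below (R : realType) (X : Type) (a b : element R X) :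
  exists m : R, forall x y, m%:E <= otimes_value a b x y.
Proof.
have [ma Ha] := value_bounded_below a.
have [mb Hb] := value_bounded_below b.
exists (ma + mb)%R => x y.
apply: le_ereal_inf_tmp => _ [z _ <-].
by rewrite EFinD leeD.
Qed.

Definition otimes (R : realType) (X : Type) (a b : element R X) :
    element R X :=
  Element (otimes_bounded_below a b).

(* Main.v *)
Require Import Defs.
From mathcomp Require Import all_boot all_order all_algebra reals.
From mathcomp Require Import boolp classical_sets constructive_ereal ereal.

Import Order.TTheory.
Local Open Scope classical_set_scope.
Local Open Scope ereal_scope.

(** This is associativity of a min-plus matrix product. A constant above -oo can be moved inside an
    infimum of a family bounded below ([ereal_infDr]), so both sides expand to iterated infima of
    [a x w + b w z + c z y] over the intermediate states [w] and [z]. They differ only in the order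
    of the infima, which can be exchanged ([ereal_inf_rangeC]). *)

Lemma element_eq (R : realType) (X : Type) (a b : element R X) :
  (forall x y, a x y = b x y) -> a = b.
Proof.
case: a b => [f hf] [g hg] /= fg.
have {}fg : f = g by apply/funext => x; apply/funext => y; exact: fg.
by rewrite fg in hf *; rewrite (Prop_irrelevance hf hg).
Qed.

Lemma eq_ereal_inf_range (R : realType) (T : Type) (f g : T -> \bar R) :
  f =1 g -> ereal_inf (range f) = ereal_inf (range g).
Proof. by move=> /funext ->. Qed.

(* The lower bound matters only for k = +oo: it keeps the infimum away from
   -oo, so that adding +oo to it gives +oo rather than -oo. *)
Lemma ereal_infDr (R : realType) (T : Type) (f : T -> \bar R) (m : R)
    (k : \bar R) : (forall t, m%:E <= f t) -> -oo < k ->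
  ereal_inf (range f) + k = ereal_inf (range (fun t => f t + k)).
Proof.
move=> fm k_gt; apply/eqP; rewrite eq_le; apply/andP; split.
  apply: le_ereal_inf_tmp => _ [t _ <-]; rewrite leeD2r//.
  by apply: ereal_inf_lbound; exists t.
(* A finite [k] can be subtracted from both sides; for [k = +oo] the right-hand side is +oo. *)
case: k k_gt => [r| |] // _.
  rewrite -leeBlDr//; apply: le_ereal_inf_tmp => _ [t _ <-].
  by rewrite leeBlDr//; apply: ereal_inf_lbound; exists t.
rewrite addey ?leey// -ltNye; apply: (@lt_le_trans _ _ m%:E); rewrite ?ltNyr//.
by apply: le_ereal_inf_tmp => _ [t _ <-].
Qed.

(** Either iterated infimum is below every [F s t], hence below the other; [le_swap] is used for [F]
    and for its transpose. *)
Lemma ereal_inf_rangeC (R : realType) (S T : Type) (F : S -> T -> \bar R) :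
  ereal_inf (range (fun s => ereal_inf (range (F s)))) =
  ereal_inf (range (fun t => ereal_inf (range (F ^~ t)))).
Proof.
have le_swap (A B : Type) (G : A -> B -> \bar R) :
    ereal_inf (range (fun s => ereal_inf (range (G s)))) <=
    ereal_inf (range (fun t => ereal_inf (range (G ^~ t)))).
  apply: le_ereal_inf_tmp => _ [t _ <-].
  apply: le_ereal_inf_tmp => _ [s _ <-].
  apply: (@le_trans _ _ (ereal_inf (range (G s)))).
    by apply: ereal_inf_lbound; exists s.
  by apply: ereal_inf_lbound; exists t.
by apply/eqP; rewrite eq_le !le_swap.
Qed.

Lemma value_gtNy (R : realType) (X : Type) (a : element R X) (x y : X) :
  -oo < a x y.
Proof.
by have [m am] := value_bounded_below a; rewrite (lt_le_trans _ (am x y)) ?ltNyr.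
Qed.

Theorem lemma4 (R : realType) (X : Type) (a b c : element R X) :
  otimes (otimes a b) c = otimes a (otimes b c).
Proof.
have [ma am] := value_bounded_below a.
have [mb bm] := value_bounded_below b.
have [mc cm] := value_bounded_below c.
apply: element_eq => x y.
transitivity (ereal_inf (range (fun z =>
    ereal_inf (range (fun w => a x w + b w z + c z y))))).
  apply: eq_ereal_inf_range => z.
  apply: (@ereal_infDr _ _ _ (ma + mb)%R); last exact: value_gtNy.
  by move=> w; rewrite EFinD leeD.
rewrite ereal_inf_rangeC; apply: eq_ereal_inf_range => w.
(* [ereal_infDr] adds on the right, so [a x w] is moved there first and moved back at the end. *)
rewrite [RHS]addeC [RHS](@ereal_infDr _ _ _ (mb + mc)%R) ?value_gtNy//; last first.
  by move=> z; rewrite EFinD leeD.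
by apply: eq_ereal_inf_range => z; rewrite [RHS]addeC addeA.
Qed.
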